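(* Let $r>0$ be an integer and let $L\subset\mathbb{P}^n$ be a linear space such that the associated finite set of points $Z\subset\mathbb{P}W^*$ does not lie on a degree-$r$ hypersurface. Then the (vanishing) ideal of $L^{\circ r}$ is generated by linear and quadratic forms.
   Context: We work over $\mathbb{C}$. $L^{\circ r}$ denotes the $r$-th coordinate-wise power of $L$: the image of $L$ under the morphism $\varphi_r\colon\mathbb{P}^n\to\mathbb{P}^n$, $[x_0:\ldots:x_n]\mapsto[x_0^r:\ldots:x_n^r]$. Let $L\subset\mathbb{P}^n$ have dimension $k$, and view $L$ as the image of a chosen linear embedding $\iota=[\ell_0:\ldots:\ell_n]\colon\mathbb{P}W\hookrightarrow\mathbb{P}^n$, where $W$ is a $(k+1)$-dimensional vector space and $\ell_0,\ldots,\ell_n\in W^*$ are linear forms. The associated finite set of points is $Z:=\{[\ell_i]\in\mathbb{P}W^*\mid 0\le i\le n,\ \ell_i\ne0\}$ (as a set, without repetitions); it spans $\mathbb{P}W^*$. ''$Z$ does not lie on a degree-$r$ hypersurface'' means that no non-zero form of degree $r$ on $W^*$ (i.e. element of $\mathrm{Sym}^rW$) vanishes on all points of $Z$. *)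

(* Defs.v *)
From HB Require Import structures.
From mathcomp Require Import all_boot all_order all_algebra.
From mathcomp Require Import reals complex mpoly.

Set Implicit Arguments.
Unset Strict Implicit.
Unset Printing Implicit Defensive.

Import GRing.Theory.
Local Open Scope ring_scope.

(* A point of the projective space of lines in V is a 1-dimensional subspace
   of V; [hcoord p v] says that p = [v], i.e. that v (necessarily nonzero) is a
   vector of homogeneous coordinates of p. *)
Definition proj (K : fieldType) (V : vectType K) : Type :=
  {p : {vspace V} | \dim p == 1%N}.

Definition hcoord (K : fieldType) (V : vectType K) (p : proj V) (v : V) : Prop :=
  v != 0 /\ v \in val p.

Definition linear_space (K : fieldType) (V : vectType K) (L : {vspace V})
    (p : proj V) : Prop :=
  (val p <= L)%VS.

Definition coord_power (K : fieldType) (n r : nat)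
    (X : proj 'rV[K]_n.+1 -> Prop) (q : proj 'rV[K]_n.+1) : Prop :=
  exists (p : proj 'rV[K]_n.+1) (x : 'rV[K]_n.+1),
    [/\ X p, hcoord p x & hcoord q (\row_i x 0 i ^+ r)].

Definition vanishing_ideal (K : fieldType) (n : nat)
    (X : proj 'rV[K]_n.+1 -> Prop) (f : {mpoly K[n.+1]}) : Prop :=
  forall p x, X p -> hcoord p x -> f.@[fun i => x 0 i] = 0.

Definition ideal_generated (A : comNzRingType) (G : A -> Prop) (f : A) : Prop :=
  exists (m : nat) (a g : 'I_m -> A),
    (forall i, G (g i)) /\ f = \sum_(i < m) a i * g i.

Definition generated_by_linear_and_quadratic_forms (K : fieldType) (n : nat)
    (I : {mpoly K[n.+1]} -> Prop) : Prop :=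
  exists G : {mpoly K[n.+1]} -> Prop,
    (forall g, G g -> g \is 1.-homog \/ g \is 2.-homog) /\
    (forall f, I f <-> ideal_generated G f).

Definition embedding_map (K : fieldType) (W : vectType K) (n : nat)
    (ell : 'I_n.+1 -> 'Hom(W, K^o)) (w : W) : 'rV[K]_n.+1 :=
  \row_i ell i w.

Definition is_linear_embedding (K : fieldType) (W : vectType K) (n : nat)
    (ell : 'I_n.+1 -> 'Hom(W, K^o)) (L : {vspace 'rV[K]_n.+1}) : Prop :=
  injective (embedding_map ell) /\
  (forall x, x \in L <-> exists w, x = embedding_map ell w).

Definition associated_points (K : fieldType) (W : vectType K) (n : nat)
    (ell : 'I_n.+1 -> 'Hom(W, K^o)) (z : proj 'Hom(W, K^o)) : Prop :=
  exists i, hcoord z (ell i).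

(* Sym W is the polynomial ring on a basis of W, an element w of W being the
   linear function l |-> l w on the dual of W. *)
Definition sym_eval (K : fieldType) (W : vectType K)
    (F : {mpoly K[\dim {:W}]}) (l : 'Hom(W, K^o)) : K :=
  F.@[fun j => l (vbasis {:W})`_j].

Definition lies_on_hypersurface (K : fieldType) (W : vectType K) (r : nat)
    (Z : proj 'Hom(W, K^o) -> Prop) : Prop :=
  exists F : {mpoly K[\dim {:W}]},
    [/\ F != 0, F \is r.-homog
      & forall z l, Z z -> hcoord z l -> sym_eval F l = 0].

(* Main.v *)
(* Write L^r for the r-th coordinate-wise power of L, and let q_i = l_i ^ r, a
   form of degree r in coordinates t of W.  The ideal of L^r is the kernel of
   x_i |-> q_i.  In characteristic 0, a functional on the degree-r forms killing
   all the q_i is a degree-r form on W^* vanishing at all the l_i, so the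
   hypothesis on Z says that the q_i span the forms of degree r.  Hence each
   monomial of degree r in t lifts to a linear form in x, and a word of d * r
   letters lifts to a product of d linear forms, one for each block of r letters.
   Transposing two adjacent letters affects at most two adjacent blocks, hence
   changes the lift by a multiple of a linear or quadratic element of the kernel.
   So modulo these elements the lift depends only on the monomial; extended
   linearly to a map lift_poly, it satisfies f = lift_poly (f (q)) for all f,
   because both sides are compatible with multiplication by the x_i. *)
Require Import Defs.
From HB Require Import structures.
From mathcomp Require Import all_boot all_order all_algebra.
From mathcomp Require Import reals complex mpoly ssrcomplements.

Set Implicit Arguments.
Unset Strict Implicit.
Unset Printing Implicit Defensive.

Import GRing.Theory Num.Theory.
Local Open Scope ring_scope.

(** * Polynomials as functions in characteristic 0 *)

Lemma mpoly_rmorph_eq (R S : comNzRingType) (n : nat)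
    (f g : {rmorphism {mpoly R[n]} -> S}) :
  (forall c, f c%:MP = g c%:MP) -> (forall i, f 'X_i = g 'X_i) -> f =1 g.
Proof.
move=> fgC fgX; apply: mpolyind => [|c m p _ _ IHp]; first by rewrite !rmorph0.
rewrite -mul_mpolyC !rmorphD !rmorphM fgC IHp; congr (_ * _ + _).
rewrite mpolyXE_id !rmorph_prod; apply: eq_bigr => i _.
by rewrite !rmorphXn fgX.
Qed.

(** In characteristic 0 the images of 0, ..., [size p] - 1 are distinct, which is more roots than a
    nonzero [p] can have. *)
Lemma poly_eq0_pchar0 (K : fieldType) (p : {poly K}) :
  [pchar K] =i pred0 -> (forall x, p.[x] = 0) -> p = 0.
Proof.
move=> /pcharf0P K0 p0; apply/eqP; apply: contraT => pN0.
pose rs := [seq i%:R : K | i <- iota 0 (size p)].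
suff: (size rs < size p)%N by rewrite size_map size_iota ltnn.
apply: max_poly_roots => //; first by apply/allP => x _; apply/rootP.
rewrite map_inj_in_uniq ?iota_uniq // => i j _ _.
wlog le_ij : i j / (i <= j)%N => [IH|/esym/eqP].
  by case: (leqP i j) => [|/ltnW] /IH // IHij /esym /IHij.
by rewrite -subr_eq0 -natrB // K0 subn_eq0 => le_ji; apply/anti_leq/andP.
Qed.

Definition vrcons (T : Type) (n : nat) (v : 'I_n -> T) (c : T)
    (i : 'I_n.+1) : T :=
  if unlift ord_max i is Some j then v j else c.

Lemma mpoly0_const (R : nzRingType) (p : {mpoly R[0]}) : p = (p@_0)%:MP.
Proof.
apply/mpolyP => m; have -> : m = 0%MM by apply/mnmP => -[].
by rewrite mcoeffC eqxx mulr1.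
Qed.

(** Induction on the number of variables: [uni] reads [p] as a univariate polynomial in the last
    variable, whose coefficients vanish everywhere by the univariate case. *)
Lemma mpoly_eq0_pchar0 (K : fieldType) (n : nat) (p : {mpoly K[n]}) :
  [pchar K] =i pred0 -> (forall v, p.@[v] = 0) -> p = 0.
Proof.
move=> K0; elim: n p => [|n IHn] p p0.
  rewrite [p]mpoly0_const -(mevalC (fun i : 'I_0 => 0) p@_0).
  by rewrite -mpoly0_const p0.
pose X i : {poly {mpoly K[n]}} :=
  if unlift ord_max i is Some j then ('X_j)%:P else 'X.
pose uni : {rmorphism {mpoly K[n.+1]} -> {poly {mpoly K[n]}}} :=
  mmap (polyC \o @mpolyC n K) X.
have evalE v c : p.@[vrcons v c] = (map_poly (meval v) (uni p)).[c].
  apply: (mpoly_rmorph_eq (f := meval (vrcons v c))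
    (g := horner_eval c \o map_poly (meval v) \o uni)) => [a|i] /=.
    by rewrite /horner_eval mevalC mmapC /= map_polyC hornerC /= mevalC.
  rewrite /horner_eval mevalXU mmapX mmap1U /vrcons /X.
  case: unliftP => [j|] _; last by rewrite map_polyX hornerX.
  by rewrite map_polyC hornerC /= mevalXU.
pose w : {rmorphism {mpoly K[n]} -> {mpoly K[n.+1]}} :=
  comp_mpoly [tuple 'X_(lift ord_max j) | j < n].
(* Substituting the last variable back recovers [p], so it is enough that [uni p] is zero. *)
have uniK : (map_poly w (uni p)).['X_ord_max] = p.
  apply: (mpoly_rmorph_eq (f := horner_eval 'X_ord_max \o map_poly w \o uni)
    (g := idfun)) => [a|i] /=.
    by rewrite /horner_eval mmapC /= map_polyC hornerC /= comp_mpolyC.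
  rewrite /horner_eval mmapX mmap1U /X.
  case: unliftP => [j|] ->; last by rewrite map_polyX hornerX.
  by rewrite map_polyC hornerC /= comp_mpolyXU -tnth_nth tnth_mktuple.
rewrite -uniK; suff -> : uni p = 0 by rewrite map_poly0 horner0.
apply/polyP => i; rewrite coef0; apply: IHn => v.
rewrite -(coef_map (meval v)).
rewrite (poly_eq0_pchar0 (p := map_poly (meval v) (uni p)) K0) ?coef0 // => x.
by rewrite -evalE.
Qed.

(** * Closure properties of generated ideals *)

Section IdealGenerated.
Variables (A : comNzRingType) (G : A -> Prop).

Lemma ideal_generated0 : ideal_generated G 0.
Proof.
by exists 0%N, (fun=> 0), (fun=> 0); split=> [[]//|]; rewrite big_ord0.
Qed.

Lemma ideal_generated_gen g : G g -> ideal_generated G g.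
Proof.
move=> Gg; exists 1%N, (fun=> 1), (fun=> g); split=> //.
by rewrite big_ord1 mul1r.
Qed.

Lemma ideal_generatedD f g :
  ideal_generated G f -> ideal_generated G g -> ideal_generated G (f + g).
Proof.
move=> [m1 [a1 [g1 [G1 ->]]]] [m2 [a2 [g2 [G2 ->]]]].
pose glue (u : 'I_m1 -> A) (v : 'I_m2 -> A) i :=
  match split i with inl j => u j | inr j => v j end.
have gluel u v i : glue u v (lshift m2 i) = u i.
  by rewrite /glue (unsplitK (inl _)).
have gluer u v i : glue u v (rshift m1 i) = v i.
  by rewrite /glue (unsplitK (inr _)).
exists (m1 + m2)%N, (glue a1 a2), (glue g1 g2); split=> [i|].
  by rewrite /glue; case: (split i).
rewrite big_split_ord /=.
by congr (_ + _); apply: eq_bigr => i _; rewrite ?gluel ?gluer.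
Qed.

Lemma ideal_generatedM h f : ideal_generated G f -> ideal_generated G (h * f).
Proof.
move=> [m [a [g [Gg ->]]]]; exists m, (fun i => h * a i), g; split=> //.
by rewrite mulr_sumr; apply: eq_bigr => i _; rewrite mulrA.
Qed.

Lemma ideal_generated_sum (I : Type) (s : seq I) (P : pred I) (F : I -> A) :
  (forall i, P i -> ideal_generated G (F i)) ->
  ideal_generated G (\sum_(i <- s | P i) F i).
Proof.
move=> JF; apply: big_rec => [|i f Pi Jf]; first exact: ideal_generated0.
by apply: ideal_generatedD => //; apply: JF.
Qed.

Lemma ideal_generated_trans g f h :
  ideal_generated G (f - g) -> ideal_generated G (g - h) ->
  ideal_generated G (f - h).
Proof. by move=> /ideal_generatedD fg /fg; rewrite addrA subrK. Qed.

End IdealGenerated.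

(** * Permutations of words, and monomials as commutative words *)

(** Adjacent swaps move a letter past a block ([move1]), hence exchange two blocks ([move2]), and
    block exchanges generate all permutations. *)
Lemma perm_swap_ind (T : eqType) (Q : seq T -> Prop) :
  (forall s1 x y s2, Q (s1 ++ x :: y :: s2) -> Q (s1 ++ y :: x :: s2)) ->
  forall s t, perm_eq s t -> Q s -> Q t.
Proof.
move=> swap.
have move1 s1 x s2 p : Q (p ++ s1 ++ x :: s2) -> Q (p ++ x :: s1 ++ s2).
  elim/last_ind: s1 s2 => [//|s1 y IHs] s2.
  by rewrite cat_rcons catA => /swap; rewrite -catA => /IHs; rewrite cat_rcons.
suff move2 s2 p s1 s3 : Q (p ++ s1 ++ s2 ++ s3) -> Q (p ++ s2 ++ s1 ++ s3).
  by apply: catCA_perm_ind => s1 s2 s3; apply: (move2 s2 [::]).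
elim: s2 p => [//|x s2 IHs] p /= /move1.
by rewrite -cat_rcons => /IHs; rewrite cat_rcons.
Qed.

Section Words.
Variable N : nat.
Implicit Types (s t : seq 'I_N) (m : 'X_{1..N}).

Definition monw s : 'X_{1..N} := (\sum_(j <- s) U_(j))%MM.

(** The sorted word serves as the canonical representative among the words with monomial [m]. *)
Definition word m : seq 'I_N := flatten [seq nseq (m i) i | i <- enum 'I_N].

Lemma monw_cat s t : monw (s ++ t) = (monw s + monw t)%MM.
Proof. exact: big_cat. Qed.

Lemma monwE s i : monw s i = count_mem i s.
Proof.
rewrite /monw mnm_sumE; elim: s => [|j s IHs]; first by rewrite big_nil.
by rewrite big_cons IHs mnm1E.
Qed.

Lemma monw_perm s t : (monw s = monw t) <-> perm_eq s t.
Proof.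
split=> [Est|/permP Est]; last by apply/mnmP => i; rewrite !monwE Est.
by apply/allP => i _ /=; rewrite -!monwE Est.
Qed.

Lemma mdeg_monw s : mdeg (monw s) = size s.
Proof.
by rewrite mdeg_sum (eq_bigr (fun=> 1%N)) ?sum1_size // => i _; rewrite mdeg1.
Qed.

Lemma wordK m : monw (word m) = m.
Proof.
rewrite /monw big_flatten /= big_map big_enum /= [RHS]multinomUE_id.
by apply: eq_bigr => i _; rewrite big_nseq /mnm_muln Monoid.iteropE.
Qed.

Lemma size_word m : size (word m) = mdeg m.
Proof. by rewrite -mdeg_monw wordK. Qed.

End Words.

(** * The kernel of x_i |-> q_i when the q_i span the forms of degree r *)

Section VeroneseKernel.
Variables (K : fieldType) (n N r : nat).
Variables (q : n.-tuple {mpoly K[N]}) (C : 'X_{1..N} -> 'I_n -> K).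
Hypothesis r_gt0 : (0 < r)%N.
Hypothesis q_homog : forall i, tnth q i \is r.-homog.
Hypothesis q_span :
  forall m, mdeg m = r -> \sum_i C m i *: tnth q i = 'X_[m].

Definition linear_quadratic_kernel (g : {mpoly K[n]}) : Prop :=
  (g \is 1.-homog \/ g \is 2.-homog) /\ g \mPo q = 0.

Local Notation J := (ideal_generated linear_quadratic_kernel).

(** A linear preimage of the monomial [m]; this is meaningful only in degree [r], where [C] is
    constrained. *)
Definition lift_mon (m : 'X_{1..N}) : {mpoly K[n]} := \sum_i C m i *: 'X_i.

Lemma lift_mon_homog m : lift_mon m \is 1.-homog.
Proof.
by apply: rpred_sum => i _; rewrite rpredZ // dhomogX; apply/eqP/mdeg1.
Qed.

Lemma comp_lift_mon m : mdeg m = r -> lift_mon m \mPo q = 'X_[m].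
Proof.
move=> dm; rewrite raddf_sum /= -q_span //; apply: eq_bigr => i _.
by rewrite comp_mpolyZ comp_mpolyXU -tnth_nth.
Qed.

Fixpoint lift_blocks (d : nat) (s : seq 'I_N) : {mpoly K[n]} :=
  if d is d'.+1 then lift_mon (monw (take r s)) * lift_blocks d' (drop r s)
  else 1.

Lemma lift_blocks_homog d s : lift_blocks d s \is d.-homog.
Proof.
elim: d s => [|d IHd] s /=; first exact: dhomog1.
by rewrite -add1n dhomogM ?lift_mon_homog.
Qed.

Lemma lift_blocks_add d e s :
  lift_blocks (d + e) s = lift_blocks d s * lift_blocks e (drop (d * r) s).
Proof.
elim: d s => [|d IHd] s /=; first by rewrite mul1r drop0.
by rewrite IHd drop_drop mulrA mulSn addnC.
Qed.

Lemma comp_lift_blocks d s :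
  (d * r <= size s)%N -> lift_blocks d s \mPo q = 'X_[monw (take (d * r) s)].
Proof.
elim: d s => [|d IHd] s les /=.
  by rewrite take0 /monw big_nil mpolyX0 comp_mpoly1.
rewrite mulSn in les *.
rewrite rmorphM /= IHd ?comp_lift_mon; last 2 first.
- by rewrite mdeg_monw size_takel // (leq_trans _ les) // leq_addr.
- by rewrite size_drop leq_subRL // (leq_trans _ les) // leq_addr.
by rewrite -mpolyXD -monw_cat takeD.
Qed.

(** The two lifts have the same image under x_i |-> q_i, and for [d] at most 2 their difference is
    itself one of the generators. *)
Lemma lift_blocks_small d s t : (0 < d <= 2)%N ->
  (d * r <= size s)%N -> size s = size t ->
  monw (take (d * r) s) = monw (take (d * r) t) ->
  J (lift_blocks d s - lift_blocks d t).
Proof.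
move=> d2 les Est Em; apply: ideal_generated_gen; split; last first.
  by rewrite comp_mpolyB !comp_lift_blocks -?Est // Em subrr.
by case: d d2 {les Em} => [|[|[|]]] //= _; [left|right]; apply: rpredB;
  apply: lift_blocks_homog.
Qed.

(** Induction on the number of blocks: either the first block is untouched and factors out, or the
    swap takes place within the first two blocks. *)
Lemma lift_blocks_swap d s1 x y s2 : size (s1 ++ x :: y :: s2) = (d * r)%N ->
  J (lift_blocks d (s1 ++ x :: y :: s2) - lift_blocks d (s1 ++ y :: x :: s2)).
Proof.
elim: d s1 => [|d IHd] s1 Es; first by move: Es; rewrite size_cat /= !addnS.
have Exy s : monw (s ++ x :: y :: s2) = monw (s ++ y :: x :: s2).
  by apply/monw_perm; rewrite perm_cat2l -cat1s -[y :: s2]cat1s perm_catCA.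
have [le2|lt2] := leqP d.+1 2.
  apply: lift_blocks_small => //; first by rewrite Es.
    by rewrite !size_cat.
  by rewrite !take_oversize // -Es // !size_cat.
(* If [s1] fills the first block, that block is a common factor and the induction hypothesis applies
   to the rest. *)
have [le_r|lt_r] := leqP r (size s1).
  have dropE t : drop r (s1 ++ t) = drop r s1 ++ t.
    by rewrite -{1}(cat_take_drop r s1) -catA drop_size_cat // size_takel.
  rewrite /= !takel_cat // !dropE -mulrBr.
  apply/ideal_generatedM/IHd.
  by rewrite -dropE size_drop Es mulSn addKn.
(* Otherwise the swapped letters end at position [(size s1).+2], at most [r + 1] and so at most
   [2 * r]: the blocks after the second coincide. *)
have [e Ed] : exists e, d.+1 = (2 + e)%N.
  by exists (d.+1 - 2)%N; rewrite subnKC // ltnW.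
rewrite Ed !lift_blocks_add.
have Edrop : drop (2 * r) (s1 ++ x :: y :: s2) =
    drop (2 * r) (s1 ++ y :: x :: s2).
  have -> : (2 * r = (2 * r - (size s1).+2) + (size s1).+2)%N.
    by rewrite subnK // mul2n -addnn -addn1 leq_add.
  rewrite -!drop_drop; congr drop.
  have cons2 u v : s1 ++ u :: v :: s2 = (s1 ++ [:: u; v]) ++ s2.
    by rewrite -catA.
  by rewrite !cons2 !drop_size_cat // size_cat /= addn2.
rewrite Edrop -mulrBl mulrC; apply/ideal_generatedM/lift_blocks_small => //.
- by rewrite Es Ed leq_mul2r leq_addr orbT.
- by rewrite !size_cat.
(* The full words have the same monomial and the same tail, so cancelling the tail equates the
   monomials of the first two blocks. *)
apply: (@addIm _ (monw (drop (2 * r) (s1 ++ x :: y :: s2)))).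
by rewrite {2}Edrop -!monw_cat !cat_take_drop.
Qed.

Lemma lift_blocks_perm d s t : perm_eq s t -> size s = (d * r)%N ->
  J (lift_blocks d s - lift_blocks d t).
Proof.
move=> Est Es.
pose Q u := size u = (d * r)%N /\ J (lift_blocks d s - lift_blocks d u).
suff [] : Q t by [].
apply: (@perm_swap_ind _ Q _ s) => //.
  move=> s1 x y s2 [Eu Ju]; split; first by rewrite -Eu !size_cat.
  by apply: ideal_generated_trans Ju _; apply: lift_blocks_swap.
by split; rewrite ?subrr //; apply: ideal_generated0.
Qed.

(* The value [0] when [r] does not divide the degree spares [lift_mon_pow_mul]
   a divisibility hypothesis on [m']. *)
Definition lift_mon_pow (m : 'X_{1..N}) : {mpoly K[n]} :=
  if (r %| mdeg m)%N then lift_blocks (mdeg m %/ r) (word m) else 0.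

(** Prepending [word m] as one full block to [word m'] gives a permutation of [word (m + m')]. *)
Lemma lift_mon_pow_mul m m' : mdeg m = r ->
  J (lift_mon m * lift_mon_pow m' - lift_mon_pow (m + m')).
Proof.
move=> dm; rewrite /lift_mon_pow mdegD dm dvdn_addr //.
case: ifP => [dvr|_]; last by rewrite mulr0 subrr; apply: ideal_generated0.
rewrite divnDl // divnn r_gt0 add1n.
have -> : lift_mon m * lift_blocks (mdeg m' %/ r) (word m') =
    lift_blocks (mdeg m' %/ r).+1 (word m ++ word m').
  by rewrite /= take_size_cat ?drop_size_cat ?size_word // wordK.
apply: lift_blocks_perm.
  by apply/monw_perm; rewrite monw_cat !wordK.
by rewrite size_cat !size_word mulSn divnK // dm.
Qed.

Definition lift_poly (p : {mpoly K[N]}) : {mpoly K[n]} :=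
  \sum_(m <- msupp p) p@_m *: lift_mon_pow m.

(** Summing over all monomials of bounded degree gives several polynomials a common index set, so
    that linearity can be checked termwise. *)
Lemma lift_polywE k p : (msize p <= k)%N ->
  lift_poly p = \sum_(m : 'X_{1..N < k}) p@_m *: lift_mon_pow m.
Proof.
move=> lek; rewrite /lift_poly.
rewrite (big_mksub 'X_{1..N < k}) //=; first last.
- by move=> m /msize_mdeg_lt /leq_trans; apply.
- exact: msupp_uniq.
by rewrite big_rmcond //= => m /memN_msupp_eq0 ->; rewrite scale0r.
Qed.

Lemma lift_polyD p p' : lift_poly (p + p') = lift_poly p + lift_poly p'.
Proof.
pose k := maxn (msize p) (maxn (msize p') (msize (p + p'))).
rewrite !(@lift_polywE k) ?leq_max ?leqnn ?orbT //.
by rewrite -big_split; apply: eq_bigr => m _; rewrite mcoeffD scalerDl.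
Qed.

Lemma lift_polyZ c p : lift_poly (c *: p) = c *: lift_poly p.
Proof.
pose k := maxn (msize p) (msize (c *: p)).
rewrite !(@lift_polywE k) ?leq_max ?leqnn ?orbT //.
by rewrite scaler_sumr; apply: eq_bigr => m _; rewrite mcoeffZ scalerA.
Qed.

Lemma lift_poly0 : lift_poly 0 = 0.
Proof. by rewrite -(scale0r 0) lift_polyZ scale0r. Qed.

Lemma lift_polyX m : lift_poly 'X_[m] = lift_mon_pow m.
Proof. by rewrite /lift_poly msuppX big_seq1 mcoeffX eqxx scale1r. Qed.

Lemma lift_poly1 : lift_poly 1 = 1.
Proof. by rewrite -mpolyX0 lift_polyX /lift_mon_pow mdeg0 dvdn0 div0n. Qed.

Lemma lift_poly_sum (I : Type) (s : seq I) (F : I -> {mpoly K[N]}) :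
  lift_poly (\sum_(i <- s) F i) = \sum_(i <- s) lift_poly (F i).
Proof. exact: (big_morph _ lift_polyD lift_poly0). Qed.

Lemma lift_poly_mulX m p : mdeg m = r ->
  J (lift_mon m * lift_poly p - lift_poly ('X_[m] * p)).
Proof.
move=> dm; have -> : 'X_[m] * p = \sum_(m' <- msupp p) p@_m' *: 'X_[m + m'].
  rewrite {1}[p]mpolyE mulr_sumr.
  by apply: eq_bigr => m' _; rewrite mpolyXD scalerAr.
rewrite lift_poly_sum {1}/lift_poly mulr_sumr -sumrB.
apply: ideal_generated_sum => m' _.
rewrite -scalerAr lift_polyZ lift_polyX -scalerBr -mul_mpolyC.
exact/ideal_generatedM/lift_mon_pow_mul.
Qed.

(** On forms of degree [r] this agrees with [lift_poly], but it is visibly a linear form. *)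
Definition lift_form (p : {mpoly K[N]}) : {mpoly K[n]} :=
  \sum_(m <- msupp p) p@_m *: lift_mon m.

Lemma lift_poly_mul_homog p p' : p \is r.-homog ->
  J (lift_form p * lift_poly p' - lift_poly (p * p')).
Proof.
move=> /dhomogP hp.
have -> : p * p' = \sum_(m <- msupp p) p@_m *: ('X_[m] * p').
  rewrite {1}[p]mpolyE mulr_suml.
  by apply: eq_bigr => m _; rewrite scalerAl.
rewrite lift_poly_sum mulr_suml -sumrB big_seq.
apply: ideal_generated_sum => m /hp dm.
rewrite -!scalerAl lift_polyZ -scalerBr -mul_mpolyC.
exact/ideal_generatedM/lift_poly_mulX.
Qed.

(** Both terms are linear forms with image q_i, so their difference is a linear generator. *)
Lemma X_lift_form i : J ('X_i - lift_form (tnth q i)).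
Proof.
apply: ideal_generated_gen; split.
  left; apply: rpredB; first by rewrite dhomogX; apply/eqP/mdeg1.
  by apply: rpred_sum => m _; rewrite rpredZ ?lift_mon_homog.
rewrite comp_mpolyB comp_mpolyXU -tnth_nth; apply/eqP; rewrite subr_eq0.
rewrite {1}[tnth q i]mpolyE raddf_sum; apply/eqP/eq_big_seq => m sm /=.
by rewrite comp_mpolyZ comp_lift_mon // (dhomog_mf (q_homog i)).
Qed.

Lemma sub_lift_polyX i g : J (g - lift_poly (g \mPo q)) ->
  J ('X_i * g - lift_poly (('X_i * g) \mPo q)).
Proof.
move=> Jg; apply: (@ideal_generated_trans _ _ ('X_i * lift_poly (g \mPo q))).
  by rewrite -mulrBr; apply: ideal_generatedM.
rewrite rmorphM /= comp_mpolyXU -tnth_nth.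
apply: ideal_generated_trans (lift_poly_mul_homog _ (q_homog i)).
by rewrite -mulrBl mulrC; apply/ideal_generatedM/X_lift_form.
Qed.

Lemma sub_lift_poly f : J (f - lift_poly (f \mPo q)).
Proof.
(* [Q h] says that multiplication by [h] preserves the congruence. It is stable under products, so
   the case of a variable yields all monomials, applied to [g] = 1. *)
pose Q h := forall g, J (g - lift_poly (g \mPo q)) ->
  J (h * g - lift_poly ((h * g) \mPo q)).
have Q1 : Q 1 by move=> g; rewrite mul1r.
have QM h h' : Q h -> Q h' -> Q (h * h').
  by move=> Qh Qh' g /Qh' /Qh; rewrite mulrA.
elim/mpolyind: f => [|c m f _ _ IHf].
  by rewrite comp_mpoly0 lift_poly0 subrr; apply: ideal_generated0.
rewrite comp_mpolyD lift_polyD opprD addrACA.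
apply: ideal_generatedD; last exact: IHf.
rewrite comp_mpolyZ lift_polyZ -scalerBr -mul_mpolyC.
apply: ideal_generatedM; rewrite -['X_[m]]mulr1 mpolyXE_id.
suff: Q (\prod_(i < n) 'X_i ^+ m i).
  by apply; rewrite comp_mpoly1 lift_poly1 subrr; apply: ideal_generated0.
apply: big_ind; [exact: Q1|exact: QM|move=> i _].
elim: (m i) => [|e IHe]; first exact: Q1.
rewrite exprS; exact: QM (@sub_lift_polyX i) IHe.
Qed.

Lemma kernel_linear_quadratic f : f \mPo q = 0 -> J f.
Proof. by move=> f0; have := sub_lift_poly f; rewrite f0 lift_poly0 subr0. Qed.

End VeroneseKernel.

(** * Powers of linear forms spanning the forms of degree r *)

Lemma homog_meval_scale (K : fieldType) (n d : nat) (f : {mpoly K[n]})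
    (c : K) (v : 'I_n -> K) :
  f \is d.-homog -> f.@[fun i => c * v i] = c ^+ d * f.@[v].
Proof.
move=> hf; rewrite !mevalE mulr_sumr; apply: eq_big_seq => m sm.
rewrite mulrCA; congr (_ * _).
under eq_bigr do rewrite exprMn.
by rewrite big_split /= prodrXr -mdegE (dhomog_mf hf).
Qed.

Section PowersSpan.
Variables (K : fieldType) (N r : nat).
Local Notation T := {ffun 'I_r -> 'I_N}.

Definition monf (u : T) : 'X_{1..N} := (\sum_t U_(u t))%MM.

Lemma mdeg_monf u : mdeg (monf u) = r.
Proof.
rewrite mdeg_sum (eq_bigr (fun=> 1%N)) ?sum1_card ?card_ord // => i _.
by rewrite mdeg1.
Qed.

Lemma monf_surj m : mdeg m = r -> exists u, monf u = m.
Proof.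
move=> dm; have sz : size (word m) == r by rewrite size_word dm.
exists [ffun t => tnth (Tuple sz) t]; rewrite -[RHS]wordK /monf /monw.
rewrite [in RHS](_ : word m = Tuple sz) // big_tuple.
by apply: eq_bigr => t _; rewrite ffunE.
Qed.

(** Expanding over words instead of monomials keeps multinomial coefficients out of the formula. *)
Lemma linear_form_expn (a : 'I_N -> K) :
  (\sum_j a j *: 'X_j) ^+ r = \sum_(u : T) (\prod_t a (u t)) *: 'X_[monf u].
Proof.
rewrite -[r in LHS]card_ord -prodr_const bigA_distr_bigA /=.
apply: eq_bigr => u _; rewrite /monf -mprodXE /=.
by rewrite scaler_prod.
Qed.

Lemma meval_monf (a : 'I_N -> K) (u : T) : 'X_[monf u].@[a] = \prod_t a (u t).
Proof.
rewrite /monf -mprodXE rmorph_prod.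
by apply: eq_bigr => t _ /=; rewrite mevalXU.
Qed.

(* A functional killing all the powers [(\sum_j a i j X_j) ^ r] is, up to
   multinomial coefficients, a form of degree [r] vanishing at all the [a i]. *)
Lemma powers_span (n : nat) (a : 'I_n -> 'I_N -> K) :
  [pchar K] =i pred0 ->
  (forall F : {mpoly K[N]},
     F \is r.-homog -> (forall i, F.@[a i] = 0) -> F = 0) ->
  exists C : 'X_{1..N} -> 'I_n -> K, forall m, mdeg m = r ->
    \sum_i C m i *: (\sum_j a i j *: 'X_j) ^+ r = 'X_[m].
Proof.
move=> /pcharf0P K0 aF.
pose ev (u : 'I_#|T|) : T := enum_val u.
(* Row i of [B] expands the i-th power over words, and [E] collects words with equal monomial. Row i
   of [B *m E] thus lists the coefficients of the i-th power, and row v of [E] those of the monomial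
   of v. *)
pose B : 'M[K]_(n, #|T|) := \matrix_(i, u) \prod_t a i (ev u t).
pose E : 'M[K]_#|T| :=
  \matrix_(u, v) (monf (ev u) == monf (ev v))%:R.
(* Every monomial is a combination of the powers. By duality, each column of the cokernel of
   [B *m E] must also kill [E]; such a column defines the form [F], whose value at [a i] is an entry
   of [B *m E *m k]. *)
have sEBE : (E <= B *m E)%MS.
  rewrite submxE; apply/eqP/matrixP => v c; rewrite [RHS]mxE.
  set k := cokermx _.
  have BEk : B *m E *m k = 0 by rewrite mulmx_coker.
  pose F : {mpoly K[N]} := \sum_u (E *m k) u c *: 'X_[monf (ev u)].
  have F0 : F = 0.
    apply: aF => [|i].
      apply: rpred_sum => u _; rewrite rpredZ // dhomogX.
      exact/eqP/mdeg_monf.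
    transitivity ((B *m E *m k) i c); last by rewrite BEk mxE.
    rewrite -mulmxA mxE raddf_sum; apply: eq_bigr => u _ /=.
    by rewrite mevalZ meval_monf !mxE mulrC.
  have Ek u w : monf (ev u) = monf (ev w) ->
      (E *m k) u c = (E *m k) w c.
    by move=> Euw; rewrite !mxE; apply: eq_bigr => x _; rewrite !mxE Euw.
  pose cls := [pred u | monf (ev u) == monf (ev v)].
  (* The size of [cls] is a multinomial coefficient, which is nonzero in characteristic 0. *)
  have : F@_(monf (ev v)) = #|cls|%:R * (E *m k) v c.
    rewrite raddf_sum /= (bigID cls) /= [X in _ + X]big1 => [|u /negbTE Nu].
      rewrite addr0 mulr_natl -sumr_const; apply: eq_bigr => u /eqP Eu.
      by rewrite mcoeffZ mcoeffX Eu eqxx mulr1; apply: Ek.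
    by rewrite mcoeffZ mcoeffX Nu mulr0.
  move/esym/eqP; rewrite F0 mcoeff0 mulf_eq0 K0 => /orP[|/eqP //].
  by move/eqP/card0_eq/(_ v); rewrite !inE eqxx.
have [D ED] := submxP sEBE.
(* Any word v of monomial [m] will do; the default 0 occurs only when the degree of [m] is not
   [r]. *)
exists (fun m i => if [pick u | monf (ev u) == m] is Some u
                   then D u i else 0) => m dm.
case: pickP => [v /eqP Ev|nov]; last first.
  have [u Eu] := monf_surj dm.
  by have := nov (enum_rank u); rewrite /ev enum_rankK Eu eqxx.
have -> : \sum_i D v i *: (\sum_j a i j *: 'X_j) ^+ r =
    \sum_u (D *m B) v u *: 'X_[monf (ev u)].
  under [RHS]eq_bigr do rewrite mxE scaler_suml.
  rewrite exchange_big /=; apply: eq_bigr => i _.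
  rewrite linear_form_expn scaler_sumr (reindex ev) /=; last first.
    by apply: onW_bij; apply: enum_val_bij.
  by apply: eq_bigr => u _; rewrite scalerA mxE.
(* Collecting [D *m B] by monomials is multiplying it by [E], and [ED] identifies the result with
   row v of [E]. *)
apply/mpolyP => m'; rewrite mcoeffX raddf_sum /=.
under eq_bigr do rewrite mcoeffZ mcoeffX.
case: (pickP [pred w | monf (ev w) == m']) => /= [w /eqP Ew|now].
  have := congr1 (fun X : 'M_#|T| => X v w) ED.
  rewrite mulmxA [in LHS]mxE [RHS]mxE Ev Ew => ->.
  by apply: eq_bigr => u _; rewrite [E _ _]mxE Ew.
have {}now u : (monf (ev u) == m') = false := now u.
by rewrite -Ev now big1 // => u _; rewrite now mulr0.
Qed.

End PowersSpan.

(** * Homogeneous coordinates of projective points *)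

Section ProjectivePoints.
Variables (K : fieldType) (V : vectType K).

Lemma hcoord_exists (v : V) : v != 0 -> exists p : proj V, hcoord p v.
Proof.
move=> v0; have dv : \dim <[v]> == 1%N by rewrite dim_vline v0.
by exists (exist _ <[v]>%VS dv); split=> //; apply: memv_line.
Qed.

Lemma hcoord_line (p : proj V) v : hcoord p v -> val p = <[v]>%VS.
Proof.
move=> [v0 pv]; apply/esym/eqP; rewrite eqEdim -memvE pv /=.
by rewrite dim_vline v0 (eqP (valP p)).
Qed.

Lemma hcoord_scale (p : proj V) u v :
  hcoord p u -> hcoord p v -> exists c, v = c *: u.
Proof. by move=> /hcoord_line pu [_]; rewrite pu => /vlineP. Qed.

End ProjectivePoints.

(** * The vanishing ideal of the coordinate-wise power *)

Section CoordinatePower.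
Variables (K : fieldType) (n r : nat) (L : {vspace 'rV[K]_n.+1}).
Variables (W : vectType K) (ell : 'I_n.+1 -> 'Hom(W, K^o)).
Hypothesis charK : [pchar K] =i pred0.
Hypothesis r_gt0 : (0 < r)%N.
Hypothesis W_gt0 : (0 < \dim {:W})%N.
Hypothesis ell_emb : is_linear_embedding ell L.

Local Notation N := (\dim {:W}).
Local Notation I := (vanishing_ideal (coord_power r (linear_space L))).

Definition coord_form (i : 'I_n.+1) : {mpoly K[N]} :=
  \sum_(j < N) (ell i (vbasis {:W})`_j : K) *: 'X_j.

Definition coord_powers : n.+1.-tuple {mpoly K[N]} :=
  [tuple coord_form i ^+ r | i < n.+1].

Lemma coord_powers_homog i : tnth coord_powers i \is r.-homog.
Proof.
rewrite tnth_mktuple -[r in r.-homog]mul1n dhomogMn //.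
by apply: rpred_sum => j _; rewrite rpredZ // dhomogX; apply/eqP/mdeg1.
Qed.

Lemma meval_coord_form (v : 'I_N -> K) i :
  (coord_form i).@[v] = ell i (\sum_(j < N) v j *: (vbasis {:W})`_j).
Proof.
rewrite raddf_sum linear_sum; apply: eq_bigr => j _ /=.
by rewrite mevalZ mevalXU linearZ mulrC.
Qed.

Lemma meval_comp_coord_powers f (v : 'I_N -> K) :
  (f \mPo coord_powers).@[v] =
  f.@[fun i => ell i (\sum_(j < N) v j *: (vbasis {:W})`_j) ^+ r].
Proof.
rewrite comp_mpoly_meval; apply: meval_eq => i.
by rewrite tnth_mktuple rmorphXn /= meval_coord_form.
Qed.

Lemma coord_basis (w : W) :
  w = \sum_(j < N) coord (vbasis {:W}) j w *: (vbasis {:W})`_j.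
Proof. by apply: coord_vbasis; rewrite memvf. Qed.

Lemma row_power_eq0 (x : 'rV[K]_n.+1) :
  (\row_i x 0 i ^+ r == 0) = (x == 0).
Proof.
apply/eqP/eqP => [/rowP x0|->]; apply/rowP => i; rewrite !mxE.
  by move: (x0 i) => /eqP; rewrite !mxE expf_eq0 r_gt0 => /eqP.
by rewrite expr0n gtn_eqF.
Qed.

Lemma vanishing_ideal_kernel f : I f -> f \mPo coord_powers = 0.
Proof.
move=> If; pose j0 : 'I_N := Ordinal W_gt0.
(* The vector w = 0 gives no projective point, so nothing is known about f(q) there. The factor
   ['X_j0] vanishes at that vector and is cancelled afterwards. *)
apply/eqP; have /eqP : (f \mPo coord_powers) * 'X_j0 = 0.
  apply: mpoly_eq0_pchar0 => // v; rewrite rmorphM /= mevalXU.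
  rewrite meval_comp_coord_powers; set w := \sum_j _.
  have [w0|wN0] := eqVneq w 0.
    have /freeP/(_ v w0 j0) -> := basis_free (vbasisP {:W}).
    by rewrite mulr0.
  pose x := embedding_map ell w; have [emb_inj LE] := ell_emb.
  have xN0 : x != 0.
    apply: contra_neq wN0 => x0; apply: emb_inj; rewrite -/x x0.
    by apply/rowP => i; rewrite !mxE linear0.
  have [p px] := hcoord_exists xN0.
  have [p' px'] : exists p', hcoord p' (\row_i x 0 i ^+ r).
    by apply: hcoord_exists; rewrite row_power_eq0.
  suff -> : f.@[fun i => ell i w ^+ r] = 0 by rewrite mul0r.
  rewrite -[RHS](If p' (\row_i x 0 i ^+ r)) //; last first.
    exists p, x; split=> //; rewrite /linear_space (hcoord_line px) -memvE LE.
    by exists w.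
  by apply: meval_eq => i; rewrite !mxE.
rewrite mulf_eq0 => /orP[//|/eqP X0].
have := mcoeffXU K j0 j0; rewrite X0 mcoeff0 eqxx => /esym/eqP.
by rewrite oner_eq0.
Qed.

(** Coordinates of a point of the power are the values of the q_i only up to a scalar [c], which
    homogeneity turns into the factor [c ^+ d]. *)
Lemma kernel_vanishing_ideal d f :
  f \is d.-homog -> f \mPo coord_powers = 0 -> I f.
Proof.
move=> hf f0 p x [p0 [x0 [Lp0 p0x0 px0]]] px.
have [c ->] := hcoord_scale px0 px.
have : x0 \in L by apply: (subvP Lp0); case: p0x0.
case: ell_emb => _ -> [w ->].
rewrite (meval_eq (v2 := fun i => c * ell i w ^+ r)); last first.
  by move=> i; rewrite !mxE.
rewrite (homog_meval_scale _ _ hf) {1}[w]coord_basis.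
rewrite -(meval_comp_coord_powers f (fun j => coord (vbasis {:W}) j w)).
by rewrite f0 meval0 mulr0.
Qed.

Lemma vanishing_ideal_generated :
  ~ lies_on_hypersurface r (associated_points ell) ->
  generated_by_linear_and_quadratic_forms I.
Proof.
move=> Zr.
(* A nonzero form vanishing at the coefficient vectors of all the [ell i] would, by homogeneity,
   vanish at every representative of every point of Z. *)
have [|C CE] := powers_span (N := N) (r := r)
    (a := fun i (j : 'I_N) => ell i (vbasis {:W})`_j : K) charK.
  move=> F hF F0; apply/eqP/negPn/negP => FN0; apply: Zr.
  exists F; split=> // z l [i zi] zl.
  have [c ->] := hcoord_scale zi zl.
  rewrite /sym_eval (meval_eq (v2 := fun j => c * ell i (vbasis {:W})`_j)).
    by rewrite (homog_meval_scale _ _ hF) F0 mulr0.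
  by move=> j; rewrite scale_lfunE.
exists (linear_quadratic_kernel coord_powers); split=> [g []//|f]; split.
  move=> /vanishing_ideal_kernel.
  apply: (kernel_linear_quadratic (r := r) (C := C)).
  - exact: r_gt0.
  - exact: coord_powers_homog.
  move=> m dm; rewrite -(CE m dm); apply: eq_bigr => i _.
  by rewrite tnth_mktuple.
(* Conversely, each generator is a homogeneous element of the kernel, so it vanishes on the
   power. *)
move=> [m [a [g [Gg ->]]]] p x Xp px.
rewrite raddf_sum big1 // => i _ /=; rewrite rmorphM /=.
have [[hg|hg] g0] := Gg i.
  by rewrite (kernel_vanishing_ideal hg g0 Xp px) mulr0.
by rewrite (kernel_vanishing_ideal hg g0 Xp px) mulr0.
Qed.

End CoordinatePower.

Theorem proposition4p2 (R : realType) (n k r : nat) (hr : (0 < r)%N)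
  (L : {vspace 'rV[complex R]_n.+1}) (hL : \dim L = k.+1)
  (W : vectType (complex R)) (hW : \dim {:W} = k.+1)
  (ell : 'I_n.+1 -> 'Hom(W, (complex R)^o)) (hell : is_linear_embedding ell L)
  (hZ : ~ lies_on_hypersurface r (associated_points ell)) :
  generated_by_linear_and_quadratic_forms
    (vanishing_ideal (coord_power r (linear_space L))).
Proof.
apply: (vanishing_ideal_generated (pchar_num _) hr _ hell hZ).
by rewrite hW.
Qed.
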